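(* If $f\in\mathcal{C}$, then $0\le \det T_{3,1}(f)\le 1$, and both bounds are sharp.
   Context: $\mathbb{D}=\{z\in\mathbb{C}:|z|<1\}$. $\mathcal{A}$ is the class of analytic functions $f$ on $\mathbb{D}$ with $f(0)=0$, $f'(0)=1$, written $f(z)=z+a_2z^2+a_3z^3+\cdots$. $\mathcal{C}=\{f\in\mathcal{A}: \mathrm{Re}[1+zf''(z)/f'(z)]>0 \text{ for all } z\in\mathbb{D}\}$ is the class of convex functions. For $f\in\mathcal{A}$, $\det T_{3,1}(f)=2\,\mathrm{Re}(a_2^2\overline{a_3})-2|a_2|^2-|a_3|^2+1$ is the determinant of the Hermitian Toeplitz matrix $\begin{pmatrix}1&a_2&a_3\\ \overline{a_2}&1&a_2\\ \overline{a_3}&\overline{a_2}&1\end{pmatrix}$. *)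

(* Defs.v *)
From Stdlib Require Import Reals Lra.
Open Scope R_scope.

Definition Cx : Type := (R * R)%type.

Definition C0 : Cx := (0, 0).
Definition C1 : Cx := (1, 0).
Definition Cre (a : Cx) : R := fst a.
Definition Cim (a : Cx) : R := snd a.
Definition Cadd (a b : Cx) : Cx := (fst a + fst b, snd a + snd b).
Definition Cmul (a b : Cx) : Cx :=
  (fst a * fst b - snd a * snd b, fst a * snd b + snd a * fst b).
Definition Cconj (a : Cx) : Cx := (fst a, - snd a).
Definition Cnorm2 (a : Cx) : R := fst a * fst a + snd a * snd a.
Definition Cinv (a : Cx) : Cx := (fst a / Cnorm2 a, - snd a / Cnorm2 a).
Definition Cnat (n : nat) : Cx := (INR n, 0).
Fixpoint Cpow (z : Cx) (n : nat) : Cx :=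
  match n with O => C1 | S m => Cmul z (Cpow z m) end.

Fixpoint Cpsum (c : nat -> Cx) (n : nat) : Cx :=
  match n with O => c O | S m => Cadd (Cpsum c m) (c (S m)) end.

Definition Cseries_sum (c : nat -> Cx) (l : Cx) : Prop :=
  Un_cv (fun n => fst (Cpsum c n)) (fst l) /\ Un_cv (fun n => snd (Cpsum c n)) (snd l).

Definition in_disk (z : Cx) : Prop := Cnorm2 z < 1.

(* A function analytic on D is represented by its Taylor coefficients a n
   (coefficient of z^n) whose power series converges on all of D. *)
Definition analytic_on_disk (a : nat -> Cx) : Prop :=
  forall z, in_disk z -> exists l, Cseries_sum (fun n => Cmul (a n) (Cpow z n)) l.

Definition classA (a : nat -> Cx) : Prop :=
  analytic_on_disk a /\ a O = C0 /\ a 1%nat = C1.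

Definition deriv1 (a : nat -> Cx) (n : nat) : Cx := Cmul (Cnat (S n)) (a (S n)).
Definition deriv2 (a : nat -> Cx) (n : nat) : Cx :=
  Cmul (Cnat (S (S n) * S n)) (a (S (S n))).

Definition convex_fun (a : nat -> Cx) : Prop :=
  classA a /\
  forall z, in_disk z ->
    exists d1 d2,
      Cseries_sum (fun n => Cmul (deriv1 a n) (Cpow z n)) d1 /\
      Cseries_sum (fun n => Cmul (deriv2 a n) (Cpow z n)) d2 /\
      d1 <> C0 /\
      0 < Cre (Cadd C1 (Cmul z (Cmul d2 (Cinv d1)))).

Definition detT31 (a : nat -> Cx) : R :=
  2 * Cre (Cmul (Cmul (a 2%nat) (a 2%nat)) (Cconj (a 3%nat)))
  - 2 * Cnorm2 (a 2%nat) - Cnorm2 (a 3%nat) + 1.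

(* Main.v *)
(* For convex [f], the positivity of [Re (1 + z f''/f')] says that the Cayley
   transform [z f'' / (2 f' + z f'')] has modulus less than 1. By Schwarz's lemma
   [omega = f'' / (2 f' + z f'')] maps the disc to the closed disc, and
   [omega 0 = a2], [omega' 0 = 3 (a3 - a2^2)], so Schwarz-Pick gives
   [3 |a3 - a2^2| <= 1 - |a2|^2]. The bounds follow since the determinant equals
   [(1 - |a2|^2)^2 - |a3 - a2^2|^2]; they are attained by [z / (1 - z)] and [z].

   The maximum principle for a quotient of power series comes from an expansion
   to third order at each point, obtained by iterated divided differences: the mean
   of [|omega|^2 + e |z|^2] over [w + t], [w - t], [w + it], [w - it] exceeds its
   value at [w] for small [t], so this function has no maximum inside the disc. *)

Require Import Defs.
From Stdlib Require Import Reals Lra Lia Classical.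
From Coquelicot Require Import Coquelicot.
Open Scope R_scope.

(** * Complex series and power series on the disc *)

(** Componentwise, so that the theory of real series applies to each part. *)
Definition Csum (c : nat -> C) (l : C) : Prop :=
  is_series (fun n => Re (c n)) (Re l) /\ is_series (fun n => Im (c n)) (Im l).

Lemma Un_cv_psum_is_series (c : nat -> Cx) (f : Cx -> R) (l : R) :
  (forall x y, f (Cadd x y) = f x + f y) ->
  Un_cv (fun n => f (Cpsum c n)) l <-> is_series (fun n => f (c n)) l.
Proof.
  intros f_add.
  assert (E : forall n, sum_n (fun n => f (c n)) n = f (Cpsum c n)).
  { induction n as [|n IH]; [apply sum_O|].
    rewrite sum_Sn, IH. simpl. rewrite f_add. reflexivity. }
  split; intros H.
  - apply is_lim_seq_Reals in H.
    apply (is_lim_seq_ext _ _ l) with (2 := H). intros n; symmetry; apply E.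
  - apply is_lim_seq_Reals. apply (is_lim_seq_ext _ _ l) with (2 := H). exact E.
Qed.

Lemma Cseries_sum_Csum (c : nat -> Cx) (l : Cx) : Cseries_sum c l <-> Csum c l.
Proof.
  unfold Cseries_sum, Csum.
  rewrite <- (Un_cv_psum_is_series c Re (Re l)) by reflexivity.
  rewrite <- (Un_cv_psum_is_series c Im (Im l)) by reflexivity.
  reflexivity.
Qed.

Lemma Csum_unique (c : nat -> C) (l m : C) : Csum c l -> Csum c m -> l = m.
Proof.
  intros [H1 H2] [H3 H4].
  rewrite (surjective_pairing l), (surjective_pairing m).
  apply is_series_unique in H1, H2, H3, H4.
  unfold Re, Im in *. congruence.
Qed.

Lemma Csum_ext (c d : nat -> C) (l : C) :
  (forall n, c n = d n) -> Csum c l -> Csum d l.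
Proof.
  intros E [H1 H2]; split;
    [apply is_series_ext with (2 := H1) | apply is_series_ext with (2 := H2)];
    intros n; now rewrite E.
Qed.

Lemma Csum_plus (c d : nat -> C) (l m : C) :
  Csum c l -> Csum d m -> Csum (fun n => c n + d n)%C (l + m)%C.
Proof.
  intros [H1 H2] [H3 H4]; split.
  - exact (is_series_plus _ _ _ _ H1 H3).
  - exact (is_series_plus _ _ _ _ H2 H4).
Qed.

Lemma Csum_scal (k : C) (c : nat -> C) (l : C) :
  Csum c l -> Csum (fun n => k * c n)%C (k * l)%C.
Proof.
  intros [H1 H2]; split.
  - exact (is_series_minus _ _ _ _
      (is_series_scal (Re k) _ _ H1) (is_series_scal (Im k) _ _ H2)).
  - exact (is_series_plus _ _ _ _
      (is_series_scal (Re k) _ _ H2) (is_series_scal (Im k) _ _ H1)).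
Qed.

Lemma Csum_incr_1 (c : nat -> C) (l : C) :
  Csum c (l + c 0%nat)%C <-> Csum (fun n => c (S n)) l.
Proof.
  split; intros [H1 H2]; split.
  - apply (is_series_incr_1 (fun n => Re (c n))). exact H1.
  - apply (is_series_incr_1 (fun n => Im (c n))). exact H2.
  - apply (is_series_decr_1 (fun n => Re (c n))).
    replace (plus _ _) with (Re l); [exact H1|].
    change (Re l = Re l + Re (c 0%nat) + - Re (c 0%nat)); ring.
  - apply (is_series_decr_1 (fun n => Im (c n))).
    replace (plus _ _) with (Im l); [exact H2|].
    change (Im l = Im l + Im (c 0%nat) + - Im (c 0%nat)); ring.
Qed.

Lemma im_le_Cmod (z : C) : Rabs (Im z) <= Cmod z.
Proof. eapply Rle_trans; [apply Rmax_r | apply Rmax_Cmod]. Qed.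

Lemma Cmod_le_Re_Im (z : C) : Cmod z <= Rabs (Re z) + Rabs (Im z).
Proof.
  unfold Cmod. apply Rsqr_incr_0_var.
  - rewrite Rsqr_sqrt by nra. unfold Rsqr, Re, Im.
    rewrite <- (pow2_abs (fst z)), <- (pow2_abs (snd z)).
    pose proof (Rabs_pos (fst z)); pose proof (Rabs_pos (snd z)); nra.
  - pose proof (Rabs_pos (Re z)); pose proof (Rabs_pos (Im z)); lra.
Qed.

Lemma is_series_le_bound (u v : nat -> R) (s : R) :
  (forall n, Rabs (u n) <= v n) -> is_series v s ->
  exists l, is_series u l /\ Rabs l <= s.
Proof.
  intros Huv Hv.
  assert (Ea : ex_series (fun n => Rabs (u n))).
  { apply (ex_series_le (fun n => Rabs (u n)) v); [|now exists s].
    intros n. unfold norm; simpl. rewrite Rabs_Rabsolu. apply Huv. }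
  exists (Series u). split.
  - apply Series_correct. now apply ex_series_Rabs.
  - eapply Rle_trans; [now apply Series_Rabs|].
    rewrite <- (is_series_unique v s Hv).
    apply Series_le; [|now exists s]. intros n; split; [apply Rabs_pos|apply Huv].
Qed.

(* The factor 2 comes from bounding real and imaginary parts separately. *)
Lemma Csum_le_bound (c : nat -> C) (v : nat -> R) (s : R) :
  (forall n, Cmod (c n) <= v n) -> is_series v s ->
  exists l, Csum c l /\ Cmod l <= 2 * s.
Proof.
  intros Hc Hv.
  destruct (is_series_le_bound (fun n => Re (c n)) v s) as [x [Hx Bx]]; trivial.
  { intros n. eapply Rle_trans; [apply re_le_Cmod|apply Hc]. }
  destruct (is_series_le_bound (fun n => Im (c n)) v s) as [y [Hy By]]; trivial.
  { intros n. eapply Rle_trans; [apply im_le_Cmod|apply Hc]. }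
  exists (x, y). split; [now split|].
  eapply Rle_trans; [apply Cmod_le_Re_Im|]. simpl. lra.
Qed.

Lemma Csum_geom_bound (a : nat -> C) (w : C) (B t : R) :
  Cmod w < t -> (forall n, Cmod (a n) * t ^ n <= B) ->
  exists l, Csum (fun n => a n * w ^ n)%C l /\ Cmod l <= 2 * (B * / (1 - Cmod w / t)).
Proof.
  intros Hw HB. pose proof (Cmod_ge_0 w) as Hw0.
  assert (Hq : 0 <= Cmod w / t < 1).
  { split; [apply Rdiv_le_0_compat; lra|].
    apply Rmult_lt_reg_r with t; [lra|]. unfold Rdiv.
    rewrite Rmult_assoc, Rinv_l; lra. }
  apply Csum_le_bound with (v := fun n => B * (Cmod w / t) ^ n).
  - intros n. rewrite Cmod_mult, Cmod_pow.
    replace (Cmod (a n) * Cmod w ^ n)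
      with (Cmod (a n) * t ^ n * (Cmod w / t) ^ n).
    + apply Rmult_le_compat_r; [apply pow_le; lra|apply HB].
    + rewrite Rmult_assoc, <- Rpow_mult_distr. do 3 f_equal. field. lra.
  - apply (is_series_scal B (fun n => (Cmod w / t) ^ n)).
    apply is_series_geom. rewrite Rabs_pos_eq; lra.
Qed.

(** * Power series of radius at least 1 and their divided differences *)

(** Radius of convergence at least 1, in a form that passes easily to shifted, differentiated and
    divided-difference coefficients. *)
Definition coeff_bound (a : nat -> C) : Prop :=
  forall t, 0 < t < 1 -> exists B, forall n, Cmod (a n) * t ^ n <= B.

Definition has_power_series (a : nat -> C) (F : C -> C) : Prop :=
  coeff_bound a /\
  forall z, Cmod z < 1 -> Csum (fun n => a n * z ^ n)%C (F z).

Lemma coeff_bound_large (a : nat -> C) (r : R) :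
  r < 1 ->
  (forall t, r < t < 1 -> 0 < t -> exists B, forall n, Cmod (a n) * t ^ n <= B) ->
  coeff_bound a.
Proof.
  intros Hr H t Ht.
  pose proof (Rmax_l t ((1 + r) / 2)); pose proof (Rmax_r t ((1 + r) / 2)).
  assert (Rmax t ((1 + r) / 2) < 1) by (apply Rmax_lub_lt; lra).
  destruct (H (Rmax t ((1 + r) / 2))) as [B HB]; try lra.
  exists B. intros n. eapply Rle_trans; [|apply HB].
  apply Rmult_le_compat_l; [apply Cmod_ge_0|]. apply pow_incr; lra.
Qed.

Lemma coeff_bound_power_series (a : nat -> C) :
  coeff_bound a -> exists F, has_power_series a F.
Proof.
  intros Ha.
  exists (fun z => (Series (fun n => Re (a n * z ^ n)%C),
                    Series (fun n => Im (a n * z ^ n)%C))).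
  split; trivial. intros z Hz. pose proof (Cmod_ge_0 z).
  destruct (Ha ((1 + Cmod z) / 2)) as [B HB]; [lra|].
  destruct (Csum_geom_bound a z B ((1 + Cmod z) / 2)) as [l [[H1 H2] _]]; [lra|trivial|].
  split; apply Series_correct; eexists; eassumption.
Qed.

(** Abel's argument: the terms of a series converging at the real point [t] are bounded. *)
Lemma coeff_bound_of_Csum (a : nat -> C) :
  (forall z, Cmod z < 1 -> exists l, Csum (fun n => a n * z ^ n)%C l) ->
  coeff_bound a.
Proof.
  intros H t Ht.
  destruct (H (RtoC t)) as [l [H1 H2]].
  { rewrite Cmod_R, Rabs_pos_eq; lra. }
  assert (bounded : forall u : nat -> R, ex_series u -> exists B, forall n, Rabs (u n) <= B).
  { intros u Hu. apply ex_series_lim_0 in Hu.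
    destruct (filterlim_bounded u) as [B HB]; [now exists 0|].
    exists B; exact HB. }
  destruct (bounded _ (ex_intro _ _ H1)) as [B1 HB1].
  destruct (bounded _ (ex_intro _ _ H2)) as [B2 HB2].
  exists (B1 + B2). intros n.
  replace (t ^ n) with (Cmod (RtoC t ^ n)).
  - rewrite <- Cmod_mult. eapply Rle_trans; [apply Cmod_le_Re_Im|].
    specialize (HB1 n); specialize (HB2 n); cbv beta in HB1, HB2; lra.
  - rewrite Cmod_pow, Cmod_R, Rabs_pos_eq; lra.
Qed.

Lemma power_series_at_0 (a : nat -> C) (F : C -> C) :
  has_power_series a F -> F 0%C = a 0%nat.
Proof.
  intros [_ H]. apply (Csum_unique (fun n => a n * 0 ^ n)%C).
  - apply H. rewrite Cmod_0; lra.
  - replace (a 0%nat) with (0 + a 0%nat * 0 ^ 0)%C by (simpl; ring).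
    apply (Csum_incr_1 (fun n => a n * 0 ^ n)%C).
    assert (Z : Csum (fun n => 0 * (a n * 0 ^ n))%C (0 * F 0)%C)
      by (apply Csum_scal, H; rewrite Cmod_0; lra).
    replace (0 * F 0)%C with (RtoC 0) in Z by ring.
    revert Z. apply Csum_ext. intros; simpl; ring.
Qed.

Definition holomorphic (F : C -> C) : Prop := exists a, has_power_series a F.

Lemma power_series_lincomb (k m : C) (a b : nat -> C) (F G : C -> C) :
  has_power_series a F -> has_power_series b G ->
  has_power_series (fun n => k * a n + m * b n)%C (fun z => k * F z + m * G z)%C.
Proof.
  intros [Ha HF] [Hb HG]. split.
  - intros t Ht. destruct (Ha t Ht) as [A HA]. destruct (Hb t Ht) as [B HB].
    exists (Cmod k * A + Cmod m * B). intros n.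
    specialize (HA n); specialize (HB n).
    assert (0 <= t ^ n) by (apply pow_le; lra).
    pose proof (Cmod_ge_0 k); pose proof (Cmod_ge_0 m).
    apply Rle_trans with (Cmod k * (Cmod (a n) * t ^ n) + Cmod m * (Cmod (b n) * t ^ n)).
    + rewrite <- !Rmult_assoc, <- !Cmod_mult, <- Rmult_plus_distr_r.
      apply Rmult_le_compat_r; trivial. apply Cmod_triangle.
    + apply Rplus_le_compat; apply Rmult_le_compat_l; trivial.
  - intros z Hz.
    apply Csum_ext with (fun n => k * (a n * z ^ n) + m * (b n * z ^ n))%C; [intros; ring|].
    apply Csum_plus; apply Csum_scal; auto.
Qed.

Lemma power_series_mul_id (a : nat -> C) (F : C -> C) :
  has_power_series a F ->
  has_power_series (fun n => match n with O => RtoC 0 | S m => a m end) (fun z => z * F z)%C.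
Proof.
  intros [Ha HF]. split.
  - intros t Ht. destruct (Ha t Ht) as [B HB]. exists B.
    assert (0 <= B).
    { eapply Rle_trans; [|apply (HB 0%nat)].
      apply Rmult_le_pos; [apply Cmod_ge_0|apply pow_le; lra]. }
    intros [|n]; [rewrite Cmod_0; lra|].
    specialize (HB n). simpl. pose proof (Cmod_ge_0 (a n)).
    assert (0 <= t ^ n) by (apply pow_le; lra). nra.
  - intros z Hz.
    replace (z * F z)%C
      with (z * F z + (fun n => match n with O => RtoC 0 | S m => a m end * z ^ n) 0%nat)%C
      by (simpl; ring).
    apply Csum_incr_1.
    apply Csum_ext with (fun n => z * (a n * z ^ n))%C; [intros; simpl; ring|].
    apply Csum_scal; auto.
Qed.

Lemma holomorphic_lincomb (k m : C) (F G : C -> C) :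
  holomorphic F -> holomorphic G -> holomorphic (fun z => k * F z + m * G z)%C.
Proof.
  intros [a Ha] [b Hb]. eexists. eapply power_series_lincomb; eassumption.
Qed.

(** The divided difference at 0, with its coefficients kept explicit: Schwarz-Pick has to read off
    [G 0 = a 1]. *)
Lemma power_series_factor_0 (a : nat -> C) (F : C -> C) :
  has_power_series a F ->
  exists G, has_power_series (fun n => a (S n)) G /\
    forall z, Cmod z < 1 -> F z = (a 0%nat + z * G z)%C.
Proof.
  intros [Ha HF].
  destruct (coeff_bound_power_series (fun n => a (S n))) as [G HG].
  - intros t Ht. destruct (Ha t Ht) as [B HB]. exists (B / t). intros n.
    apply Rmult_le_reg_r with t; [lra|].
    specialize (HB (S n)). simpl in HB.
    replace (B / t * t) with B by (field; lra). lra.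
  - exists G. split; trivial. intros z Hz.
    apply (Csum_unique _ _ _ (HF z Hz)).
    replace (a 0%nat + z * G z)%C with (z * G z + (fun n => a n * z ^ n) 0%nat)%C
      by (simpl; ring).
    apply (Csum_incr_1 (fun n => a n * z ^ n)%C).
    apply Csum_ext with (fun n => z * (a (S n) * z ^ n))%C; [intros; simpl; ring|].
    apply Csum_scal, HG, Hz.
Qed.

(* The quotient has coefficients [b k = sum_m a (k+1+m) w^m], which satisfy
   [b k = a (k+1) + w b (k+1)]. *)
Lemma holomorphic_divided_difference (F : C -> C) (w : C) :
  holomorphic F -> Cmod w < 1 ->
  exists G, holomorphic G /\
    forall z, Cmod z < 1 -> F z = (F w + (z - w) * G z)%C.
Proof.
  intros [a [Ha HF]] Hw. pose proof (Cmod_ge_0 w) as Hw0.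
  set (b := fun k => (Series (fun m => Re (a (S k + m)%nat * w ^ m)%C),
                      Series (fun m => Im (a (S k + m)%nat * w ^ m)%C)) : C).
  (* The bound obtained for [Cmod (b k) * t ^ k] is independent of [k]; this is what makes [b] the
     coefficients of a power series on the disc. *)
  assert (bound : forall t k B, Cmod w < t ->
    (forall n, Cmod (a n) * t ^ n <= B) ->
    Csum (fun m => a (S k + m)%nat * w ^ m)%C (b k) /\
    Cmod (b k) * t ^ k <= 2 * (B / t * / (1 - Cmod w / t))).
  { intros t k B Ht HB.
    assert (0 < t ^ S k) by (apply pow_lt; lra).
    destruct (Csum_geom_bound (fun m => a (S k + m)%nat) w (B / t ^ S k) t)
      as [l [Hl Bl]]; trivial.
    { intros m. apply Rmult_le_reg_r with (t ^ S k); trivial.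
      replace (B / t ^ S k * t ^ S k) with B by (field; lra).
      rewrite Rmult_assoc, <- pow_add, Nat.add_comm with (m := S k). apply HB. }
    assert (E : Csum (fun m => a (S k + m)%nat * w ^ m)%C (b k)).
    { destruct Hl as [H1 H2].
      split; apply Series_correct; eexists; eassumption. }
    split; trivial. rewrite (Csum_unique _ _ _ E Hl).
    assert (0 < t ^ k) by (apply pow_lt; lra).
    replace (2 * (B / t * / (1 - Cmod w / t)))
      with (2 * (B / t ^ S k * / (1 - Cmod w / t)) * t ^ k).
    - apply Rmult_le_compat_r; lra.
    - simpl. field. repeat split; try lra. }
  assert (Hb : forall k, Csum (fun m => a (S k + m)%nat * w ^ m)%C (b k)).
  { intros k. destruct (Ha ((1 + Cmod w) / 2)) as [B HB]; [lra|].
    apply (bound ((1 + Cmod w) / 2) k B); [lra|trivial]. }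
  assert (b_rec : forall k, b k = (a (S k) + w * b (S k))%C).
  { intros k. apply (Csum_unique _ _ _ (Hb k)).
    replace (a (S k) + w * b (S k))%C
      with (w * b (S k) + (fun m => a (S k + m)%nat * w ^ m) 0%nat)%C
      by (simpl; rewrite Nat.add_0_r; ring).
    apply (Csum_incr_1 (fun m => a (S k + m)%nat * w ^ m)%C).
    apply Csum_ext with (fun m => w * (a (S (S k) + m)%nat * w ^ m))%C.
    - intros m. replace (S k + S m)%nat with (S (S k) + m)%nat by lia. simpl; ring.
    - apply Csum_scal, Hb. }
  assert (F_rec : F w = (a 0%nat + w * b 0%nat)%C).
  { apply (Csum_unique _ _ _ (HF w Hw)).
    replace (a 0%nat + w * b 0%nat)%C
      with (w * b 0%nat + (fun n => a n * w ^ n) 0%nat)%C by (simpl; ring).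
    apply (Csum_incr_1 (fun n => a n * w ^ n)%C).
    apply Csum_ext with (fun m => w * (a (1 + m)%nat * w ^ m))%C.
    - intros m. simpl; ring.
    - apply Csum_scal, Hb. }
  destruct (coeff_bound_power_series b) as [G HG].
  { apply coeff_bound_large with (Cmod w); trivial. intros t Ht Ht0.
    destruct (Ha t) as [B HB]; [lra|]. eexists. intros k.
    apply (bound t k B); [lra|trivial]. }
  exists G. split; [now exists b|]. intros z Hz.
  (* The series of [c] sums to [F w + z * G z]. By the recurrences, [c n - a n = w * b n] for every
     [n], hence [w * G z = z * G z + F w - F z]. *)
  set (c := fun n => match n with O => F w | S k => b k end).
  assert (Hc : Csum (fun n => c n * z ^ n)%C (z * G z + F w)%C).
  { replace (F w) with ((fun n => c n * z ^ n)%C 0%nat) by (simpl; ring).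
    apply (Csum_incr_1 (fun n => c n * z ^ n)%C).
    apply Csum_ext with (fun n => z * (b n * z ^ n))%C; [intros; simpl; ring|].
    apply Csum_scal, HG, Hz. }
  assert (E : (w * G z)%C = (z * G z + F w + (-1) * F z)%C).
  { apply (Csum_unique (fun n => w * (b n * z ^ n))%C).
    - apply Csum_scal, HG, Hz.
    - apply Csum_ext with (fun n => c n * z ^ n + (-1) * (a n * z ^ n))%C.
      + intros [|n]; simpl; [rewrite F_rec|rewrite (b_rec n)]; ring.
      + apply Csum_plus; [trivial|]. apply Csum_scal; auto. }
  replace ((z - w) * G z)%C with (z * G z - w * G z)%C by ring.
  rewrite E. ring.
Qed.

Lemma holomorphic_locally_bounded (F : C -> C) (w : C) :
  holomorphic F -> Cmod w < 1 ->
  exists d K, 0 < d /\ 0 < K /\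
    forall z, Cmod (z - w) < d -> Cmod z < 1 /\ Cmod (F z) <= K.
Proof.
  intros [a [Ha HF]] Hw. pose proof (Cmod_ge_0 w).
  (* Here [Cmod w < rho < t < 1]: points near [w] stay inside radius [rho], and the coefficient
     bound at [t] gives geometric decay of ratio at most [rho / t]. *)
  set (t := (3 + Cmod w) / 4). set (rho := (1 + Cmod w) / 2).
  destruct (Ha t) as [B HB]; [unfold t; lra|].
  assert (B0 : 0 <= B).
  { eapply Rle_trans; [|apply (HB 0%nat)].
    apply Rmult_le_pos; [apply Cmod_ge_0|simpl; lra]. }
  assert (Hq : 0 < 1 - rho / t).
  { replace (1 - rho / t) with ((t - rho) / t) by (field; unfold t; lra).
    apply Rdiv_lt_0_compat; unfold t, rho; lra. }
  exists ((1 - Cmod w) / 2), (2 * (B * / (1 - rho / t)) + 1).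
  split; [lra|]. split.
  { assert (0 < / (1 - rho / t)) by now apply Rinv_0_lt_compat. nra. }
  intros z Hz.
  assert (Cmod z < rho).
  { replace z with ((z - w) + w)%C by ring.
    pose proof (Cmod_triangle (z - w) w). unfold rho; lra. }
  split; [unfold rho in *; lra|].
  destruct (Csum_geom_bound a z B t) as [l [Hl Bl]]; [unfold rho, t in *; lra|trivial|].
  rewrite (Csum_unique _ _ _ (HF z ltac:(unfold rho in *; lra)) Hl).
  assert (/ (1 - Cmod z / t) <= / (1 - rho / t)).
  { apply Rinv_le_contravar; trivial.
    apply Rplus_le_compat_l, Ropp_le_contravar.
    apply Rmult_le_compat_r; [apply Rlt_le, Rinv_0_lt_compat; unfold t; lra|lra]. }
  nra.
Qed.

(** * Maximum principle for quotients of power series *)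

(** A substitute for holomorphy of [f] that avoids inverting a power series: only numerators change,
    over a fixed [D]. *)
Definition quotient_by (D f : C -> C) : Prop :=
  exists N, holomorphic N /\ forall z, Cmod z < 1 -> f z = (N z / D z)%C.

(* Repeated divided differences of a quotient keep the same denominator. *)
Lemma quotient_by_divided_difference (D f : C -> C) (w : C) :
  holomorphic D -> (forall z, Cmod z < 1 -> D z <> 0) ->
  quotient_by D f -> Cmod w < 1 ->
  exists g, quotient_by D g /\
    forall z, Cmod z < 1 -> f z = (f w + (z - w) * g z)%C.
Proof.
  intros HD D0 [N [HN Hf]] Hw.
  (* The function [N - f w * D] vanishes at [w], so it equals [(z - w) * Q z]; dividing by [D] gives
     [f z - f w]. *)
  destruct (holomorphic_divided_difference
    (fun z => 1 * N z + (- f w) * D z)%C w) as [Q [HQ E]]; trivial.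
  { now apply holomorphic_lincomb. }
  exists (fun z => Q z / D z)%C. split; [now exists Q|]. intros z Hz.
  specialize (E z Hz). rewrite (Hf w Hw) in *.
  rewrite (Hf z Hz).
  assert (Dz := D0 z Hz). assert (Dw := D0 w Hw).
  replace (N z) with (N w / D w * D z + (z - w) * Q z)%C.
  - field. auto.
  - transitivity (N w / D w * D z + (1 * N z + - (N w / D w) * D z))%C.
    + rewrite E. field. auto.
    + ring.
Qed.

(** Since [D z = D w + (z - w) * G z] with [G] bounded by [K2] near [w], the modulus of [D] stays
    above half of [m = Cmod (D w)] within distance [m / (2 * K2)]. *)
Lemma quotient_by_locally_bounded (D f : C -> C) (w : C) :
  holomorphic D -> D w <> 0 -> quotient_by D f -> Cmod w < 1 ->
  exists d K, 0 < d /\ 0 < K /\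
    forall z, Cmod (z - w) < d -> Cmod z < 1 /\ Cmod (f z) <= K.
Proof.
  intros HD Dw [N [HN Hf]] Hw.
  destruct (holomorphic_locally_bounded N w HN Hw) as [d1 [K1 [Hd1 [HK1 H1]]]].
  destruct (holomorphic_divided_difference D w HD Hw) as [G [HG EG]].
  destruct (holomorphic_locally_bounded G w HG Hw) as [d2 [K2 [Hd2 [HK2 H2]]]].
  apply Cmod_gt_0 in Dw. set (m := Cmod (D w)) in *.
  assert (0 < m / (2 * K2)) by (apply Rdiv_lt_0_compat; lra).
  exists (Rmin d1 (Rmin d2 (m / (2 * K2)))), (K1 * (2 / m)).
  split; [repeat apply Rmin_pos; trivial|].
  split; [apply Rmult_lt_0_compat; trivial; apply Rdiv_lt_0_compat; lra|].
  intros z Hz.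
  pose proof (Rmin_l d1 (Rmin d2 (m / (2 * K2)))).
  pose proof (Rmin_r d1 (Rmin d2 (m / (2 * K2)))).
  pose proof (Rmin_l d2 (m / (2 * K2))). pose proof (Rmin_r d2 (m / (2 * K2))).
  destruct (H1 z) as [Hz1 HN1]; [lra|]. destruct (H2 z) as [_ HG1]; [lra|].
  split; trivial.
  assert (Dz : m / 2 <= Cmod (D z)).
  { pose proof (Cmod_triangle (D z) (- ((z - w) * G z))) as T.
    replace (D z + - ((z - w) * G z))%C with (D w) in T by (rewrite (EG z Hz1); ring).
    rewrite Cmod_opp, Cmod_mult in T. fold m in T.
    assert (Cmod (z - w) * Cmod (G z) <= m / (2 * K2) * K2).
    { apply Rmult_le_compat; try apply Cmod_ge_0; lra. }
    replace (m / (2 * K2) * K2) with (m / 2) in * by (field; lra). lra. }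
  assert (D z <> 0) by (apply Cmod_gt_0; lra).
  rewrite (Hf z Hz1), Cmod_div by trivial. unfold Rdiv.
  apply Rmult_le_compat; try apply Cmod_ge_0; trivial.
  - apply Rlt_le, Rinv_0_lt_compat; lra.
  - replace (2 * / m) with (/ (m / 2)) by (field; lra).
    apply Rinv_le_contravar; lra.
Qed.

(** A discrete Parseval identity: summing over the four fourth roots of unity cancels all cross
    terms between degrees 0, 1 and 2. *)
Lemma four_point_mean_quadratic (p q s : C) (t : R) :
  Cmod (p + q * RtoC t + s * (RtoC t * RtoC t)) ^ 2
  + Cmod (p + q * (- RtoC t) + s * (- RtoC t * - RtoC t)) ^ 2
  + Cmod (p + q * (Ci * RtoC t) + s * (Ci * RtoC t * (Ci * RtoC t))) ^ 2
  + Cmod (p + q * (- (Ci * RtoC t)) + s * (- (Ci * RtoC t) * - (Ci * RtoC t))) ^ 2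
  = 4 * (Cmod p ^ 2 + Cmod q ^ 2 * t ^ 2 + Cmod s ^ 2 * t ^ 4).
Proof.
  rewrite !Cmod2_alt. destruct p, q, s. simpl. ring.
Qed.

(** If [Cmod E < Cmod P], expand [(Cmod P - Cmod E) ^ 2]; otherwise [Cmod P ^ 2 <= B * e] and the
    left side is not positive. *)
Lemma Cmod_sqr_plus_ge (P E : C) (B e : R) :
  Cmod P <= B -> Cmod E <= e -> Cmod P ^ 2 - 2 * B * e <= Cmod (P + E) ^ 2.
Proof.
  intros HP HE. pose proof (Cmod_ge_0 P). pose proof (Cmod_ge_0 E).
  pose proof (Cmod_ge_0 (P + E)).
  pose proof (Cmod_triangle (P + E) (- E)) as T.
  replace (P + E + - E)%C with P in T by ring. rewrite Cmod_opp in T.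
  destruct (Rle_dec (Cmod P) (Cmod E)).
  - assert (Cmod P * Cmod P <= B * e) by (apply Rmult_le_compat; lra).
    assert (0 <= B * e) by (apply Rmult_le_pos; lra). nra.
  - assert ((Cmod P - Cmod E) ^ 2 <= Cmod (P + E) ^ 2) by (apply pow_incr; lra).
    assert (Cmod P * Cmod E <= B * e) by (apply Rmult_le_compat; lra). nra.
Qed.

(* Up to a cubic error, the squared modulus of a quotient is subharmonic. *)
Lemma quotient_by_four_point_mean (D f : C -> C) (w : C) :
  holomorphic D -> (forall z, Cmod z < 1 -> D z <> 0) ->
  quotient_by D f -> Cmod w < 1 ->
  exists d K, 0 < d /\ 0 < K /\ forall t, 0 < t < d ->
    4 * Cmod (f w) ^ 2 - K * t ^ 3 <=
    Cmod (f (w + RtoC t)%C) ^ 2 + Cmod (f (w + - RtoC t)%C) ^ 2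
    + Cmod (f (w + Ci * RtoC t)%C) ^ 2 + Cmod (f (w + - (Ci * RtoC t))%C) ^ 2.
Proof.
  intros HD D0 Hf Hw.
  destruct (quotient_by_divided_difference D f w HD D0 Hf Hw) as [g1 [Hg1 E1]].
  destruct (quotient_by_divided_difference D g1 w HD D0 Hg1 Hw) as [g2 [Hg2 E2]].
  destruct (quotient_by_divided_difference D g2 w HD D0 Hg2 Hw) as [g3 [Hg3 E3]].
  destruct (quotient_by_locally_bounded D g3 w HD (D0 w Hw) Hg3 Hw)
    as [d [K [Hd [HK Hb]]]].
  set (B := Cmod (f w) + Cmod (g1 w) + Cmod (g2 w)).
  pose proof (Cmod_ge_0 (f w)); pose proof (Cmod_ge_0 (g1 w)); pose proof (Cmod_ge_0 (g2 w)).
  (* Each of the four points loses at most [2 * B * K * t ^ 3]; the added 1 keeps the constant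
     positive. Having [t <= 1] lets [B] bound the quadratic part. *)
  exists (Rmin d 1), (8 * B * K + 1).
  split; [apply Rmin_pos; lra|].
  split; [assert (0 <= B * K) by (apply Rmult_le_pos; unfold B; lra); lra|].
  intros t Ht. pose proof (Rmin_l d 1); pose proof (Rmin_r d 1).
  assert (t3 : 0 < t ^ 3) by (apply pow_lt; lra).
  assert (one : forall h, Cmod h = t ->
    Cmod (f w + g1 w * h + g2 w * (h * h)) ^ 2 - 2 * B * (K * t ^ 3) <= Cmod (f (w + h)%C) ^ 2).
  { intros h Hh.
    destruct (Hb (w + h)%C) as [Hz Hg].
    { replace (w + h - w)%C with h by ring. lra. }
    replace (f (w + h)%C)
      with (f w + g1 w * h + g2 w * (h * h) + h * h * h * g3 (w + h))%C.
    2: { rewrite (E1 _ Hz), (E2 _ Hz), (E3 _ Hz). ring. }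
    apply Cmod_sqr_plus_ge.
    - eapply Rle_trans; [apply Cmod_triangle|].
      eapply Rle_trans; [apply Rplus_le_compat_r, Cmod_triangle|].
      rewrite !Cmod_mult, Hh. unfold B.
      assert (t * t <= 1) by nra.
      assert (Cmod (g1 w) * t <= Cmod (g1 w)) by nra.
      assert (Cmod (g2 w) * (t * t) <= Cmod (g2 w)) by nra. lra.
    - rewrite !Cmod_mult, Hh. simpl. rewrite Rmult_1_r.
      replace (t * t * t) with (t * (t * t)) by ring.
      rewrite Rmult_comm. apply Rmult_le_compat_r; trivial. simpl in t3. lra. }
  assert (Mt : Cmod (RtoC t) = t) by (rewrite Cmod_R, Rabs_pos_eq; lra).
  assert (Mi : Cmod (Ci * RtoC t) = t) by (rewrite Cmod_mult, Cmod_Ci, Mt; ring).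
  pose proof (one _ Mt) as P1. pose proof (one _ Mi) as P3.
  assert (P2 := one (- RtoC t)%C). rewrite Cmod_opp in P2. specialize (P2 Mt).
  assert (P4 := one (- (Ci * RtoC t))%C). rewrite Cmod_opp in P4. specialize (P4 Mi).
  pose proof (four_point_mean_quadratic (f w) (g1 w) (g2 w) t) as Q.
  assert (0 <= Cmod (g1 w) ^ 2 * t ^ 2) by (apply Rmult_le_pos; apply pow2_ge_0).
  assert (0 <= Cmod (g2 w) ^ 2 * t ^ 4)
    by (apply Rmult_le_pos; [apply pow2_ge_0|apply pow_le; lra]).
  lra.
Qed.

(** * Compactness of the closed disc and the maximum principle *)

(** Compactness of an interval in terms of a grill: [dom] is upward closed, omits the empty set, and
    contains one of two sets whose union it contains. The point is the supremum of the [x] for which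
    the part of the interval up to [x] is not in [dom]. *)
Lemma prime_family_point (dom : (R -> Prop) -> Prop) (a b : R) :
  (forall A B : R -> Prop, (forall x, A x -> B x) -> dom A -> dom B) ->
  (forall A B : R -> Prop, dom (fun x => A x \/ B x) -> dom A \/ dom B) ->
  ~ dom (fun _ => False) ->
  dom (fun x => a <= x <= b) ->
  exists x, forall e, 0 < e -> dom (fun y => Rabs (y - x) < e).
Proof.
  intros mono prime nonempty Hab.
  destruct (completeness (fun x => ~ dom (fun y => a <= y <= b /\ y <= x))) as [s [Hub Hlub]].
  - exists b. intros x Hx. apply Rnot_lt_le; intros Hbx. apply Hx.
    revert Hab. apply mono. intros; lra.
  - exists (a - 1). intros H. apply nonempty. revert H. apply mono. intros; lra.
  - exists s. intros e He.
    assert (H1 : exists x, s - e < x /\ ~ dom (fun y => a <= y <= b /\ y <= x)).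
    { apply NNPP; intros N. assert (s <= s - e); [|lra].
      apply Hlub. intros x Hx. apply Rnot_lt_le; intros Hlt. apply N. now exists x. }
    destruct H1 as [x [Hx Nx]].
    assert (H2 : dom (fun y => a <= y <= b /\ y <= s + e / 2)).
    { apply NNPP; intros N. apply Hub in N. lra. }
    destruct (prime (fun y => a <= y <= b /\ y <= x) (fun y => Rabs (y - s) < e)) as [H|H];
      [|contradiction|trivial].
    revert H2. apply mono. intros y [Hy Hys].
    destruct (Rle_dec y x); [left; lra|right; apply Rabs_def1; lra].
Qed.

(** The hypothesis is upper semicontinuity. The sets on which [u] reaches at least every value it
    takes on the disc form a grill; a cluster point of it, found one coordinate at a time, is a
    maximum. *)
Lemma disc_max (u : C -> R) (r : R) :
  0 <= r ->
  (forall w e, Cmod w <= r -> 0 < e -> exists d, 0 < d /\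
     forall z, Cmod z <= r -> Cmod (z - w) < d -> u z < u w + e) ->
  exists w, Cmod w <= r /\ forall z, Cmod z <= r -> u z <= u w.
Proof.
  intros Hr usc.
  set (dom := fun A : C -> Prop =>
    forall z, Cmod z <= r -> exists y, Cmod y <= r /\ A y /\ u z <= u y).
  assert (mono : forall A B : C -> Prop, (forall x, A x -> B x) -> dom A -> dom B).
  { intros A B AB HA z Hz. destruct (HA z Hz) as [y [H1 [H2 H3]]]. exists y; auto. }
  assert (prime : forall A B : C -> Prop, dom (fun x => A x \/ B x) -> dom A \/ dom B).
  { intros A B HAB. apply NNPP; intros N. apply not_or_and in N. destruct N as [NA NB].
    apply not_all_ex_not in NA, NB. destruct NA as [z1 N1], NB as [z2 N2].
    apply imply_to_and in N1, N2. destruct N1 as [Hz1 N1], N2 as [Hz2 N2].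
    destruct (Rle_dec (u z1) (u z2)).
    - destruct (HAB z2 Hz2) as [y [H1 [[H2|H2] H3]]].
      + apply N1. exists y. repeat split; trivial. lra.
      + apply N2. exists y. auto.
    - destruct (HAB z1 Hz1) as [y [H1 [[H2|H2] H3]]].
      + apply N1. exists y. auto.
      + apply N2. exists y. repeat split; trivial. lra. }
  assert (nonempty : ~ dom (fun _ => False)).
  { intros H. destruct (H 0%C) as [y [_ [[] _]]]. rewrite Cmod_0; trivial. }
  destruct (prime_family_point (fun A => dom (fun z => A (Re z))) (- r) r) as [x Hx].
  { intros A B AB. apply mono. auto. }
  { intros A B. apply prime. }
  { exact nonempty. }
  { intros z Hz. exists z. repeat split; trivial; try lra;
      pose proof (re_le_Cmod z) as T; apply Rabs_le_between in T; lra. }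
  (* The second family already requires the real part to be near [x], at every scale [e]; primeness
     survives by passing to the smaller of two scales. *)
  destruct (prime_family_point
    (fun A => forall e, 0 < e -> dom (fun z => Rabs (Re z - x) < e /\ A (Im z))) (- r) r) as [y Hy].
  { intros A B AB H e He. generalize (H e He). apply mono. intuition. }
  { intros A B H. apply NNPP; intros N. apply not_or_and in N. destruct N as [NA NB].
    apply not_all_ex_not in NA, NB. destruct NA as [e1 N1], NB as [e2 N2].
    apply imply_to_and in N1, N2. destruct N1 as [He1 N1], N2 as [He2 N2].
    pose proof (Rmin_l e1 e2); pose proof (Rmin_r e1 e2).
    destruct (prime (fun z => Rabs (Re z - x) < e1 /\ A (Im z))
                    (fun z => Rabs (Re z - x) < e2 /\ B (Im z))) as [D|D]; try contradiction.
    generalize (H (Rmin e1 e2) (Rmin_pos _ _ He1 He2)). apply mono.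
    intros z [Hzx [HA|HB]]; [left|right]; split; trivial; lra. }
  { intros H. apply nonempty. generalize (H 1 Rlt_0_1). apply mono. tauto. }
  { intros e He. generalize (Hx e He). intros H z Hz.
    destruct (H z Hz) as [v [H1 [H2 H3]]]. exists v. repeat split; trivial;
      pose proof (im_le_Cmod v) as T; apply Rabs_le_between in T; lra. }
  set (w := (x, y) : C).
  assert (near : forall e, 0 < e -> dom (fun z => Cmod (z - w) < e)).
  { intros e He. generalize (Hy (e / 2) ltac:(lra) (e / 2) ltac:(lra)). apply mono.
    intros z [H1 H2]. eapply Rle_lt_trans; [apply Cmod_le_Re_Im|].
    change (Rabs (Re z - x) + Rabs (Im z - y) < e). lra. }
  assert (Hw : Cmod w <= r).
  { apply Rnot_lt_le; intros Hlt.
    destruct (near (Cmod w - r) ltac:(lra) 0%C) as [v [H1 [H2 _]]].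
    { rewrite Cmod_0; trivial. }
    pose proof (Cmod_triangle v (- (v - w))) as T. rewrite Cmod_opp in T.
    replace (v + - (v - w))%C with w in T by ring. lra. }
  exists w. split; trivial. intros z Hz. apply Rnot_lt_le; intros Hlt.
  destruct (usc w (u z - u w) Hw ltac:(lra)) as [d [Hd H]].
  destruct (near d Hd z Hz) as [v [H1 [H2 H3]]].
  specialize (H v H1 H2). lra.
Qed.

Lemma quotient_by_max_principle (D f : C -> C) (r M : R) :
  holomorphic D -> (forall z, Cmod z < 1 -> D z <> 0) -> quotient_by D f ->
  0 < r < 1 -> (forall z, Cmod z = r -> Cmod (f z) <= M) ->
  forall z, Cmod z <= r -> Cmod (f z) <= M.
Proof.
  intros HD D0 Hf Hr HM z1 Hz1. apply Rnot_lt_le; intros Hlt.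
  assert (M0 : 0 <= M).
  { eapply Rle_trans; [|apply (HM (RtoC r))]; [apply Cmod_ge_0|].
    rewrite Cmod_R, Rabs_pos_eq; lra. }
  (* Half the gap: on the circle [u] is at most [M ^ 2 + e], still below [u z1], so the maximum of
     [u] is interior. *)
  set (e := (Cmod (f z1) ^ 2 - M ^ 2) / 2).
  assert (He : 0 < e) by (unfold e; nra).
  set (u := fun z => Cmod (f z) ^ 2 + e * Cmod z ^ 2).
  destruct (disc_max u r) as [w [Hw Hmax]]; [lra| |].
  { intros w eta Hw Heta.
    destruct (quotient_by_divided_difference D f w HD D0 Hf ltac:(lra)) as [g [Hg E]].
    destruct (quotient_by_locally_bounded D g w HD (D0 w ltac:(lra)) Hg ltac:(lra))
      as [d [K [Hd [HK Hb]]]].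
    (* A one-sided Lipschitz constant for [u] at [w]: for [h <= 1], [Cmod (f z) ^ 2] grows by at
       most [h * (2 * Cmod (f w) + K) * K] and [Cmod z ^ 2] by at most [3 * h]. *)
    set (L := (2 * Cmod (f w) + K) * K + e * 3).
    pose proof (Cmod_ge_0 (f w)). pose proof (Cmod_ge_0 w).
    assert (HL : 0 < L).
    { unfold L. assert (0 < (2 * Cmod (f w) + K) * K) by (apply Rmult_lt_0_compat; lra). lra. }
    assert (0 < eta / L) by (apply Rdiv_lt_0_compat; lra).
    exists (Rmin (Rmin d 1) (eta / L)). split; [repeat apply Rmin_pos; lra|].
    intros z Hz Hzw.
    pose proof (Rmin_l (Rmin d 1) (eta / L)). pose proof (Rmin_r (Rmin d 1) (eta / L)).
    pose proof (Rmin_l d 1). pose proof (Rmin_r d 1).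
    destruct (Hb z ltac:(lra)) as [Hz' Hgz].
    set (h := Cmod (z - w)) in *. assert (0 <= h) by apply Cmod_ge_0.
    assert (F1 : Cmod (f z) <= Cmod (f w) + h * K).
    { rewrite (E z Hz'). eapply Rle_trans; [apply Cmod_triangle|].
      rewrite Cmod_mult. apply Rplus_le_compat_l, Rmult_le_compat_l; trivial. }
    assert (F2 : Cmod z <= Cmod w + h).
    { replace z with (w + (z - w))%C at 1 by ring. apply Cmod_triangle. }
    assert (F3 : h * L < eta).
    { replace eta with (eta / L * L) by (field; lra).
      apply Rmult_lt_compat_r; lra. }
    assert (F4 : Cmod (f z) ^ 2 <= (Cmod (f w) + h * K) ^ 2)
      by (apply pow_incr; split; [apply Cmod_ge_0|trivial]).
    assert (F5 : Cmod z ^ 2 <= (Cmod w + h) ^ 2)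
      by (apply pow_incr; split; [apply Cmod_ge_0|trivial]).
    assert (F6 : (h * K) ^ 2 <= h * (K * K)).
    { replace ((h * K) ^ 2) with (h * (h * (K * K))) by ring.
      apply Rmult_le_compat_l; trivial. assert (0 <= K * K) by nra. nra. }
    assert (F7 : e * Cmod z ^ 2 <= e * (Cmod w ^ 2 + h * 3)).
    { apply Rmult_le_compat_l; nra. }
    unfold u, L in *. nra. }
  assert (Hw1 : Cmod w < r).
  { destruct Hw as [Hw|Hw]; trivial. exfalso.
    specialize (Hmax z1 Hz1). unfold u in Hmax. specialize (HM w Hw). rewrite Hw in Hmax.
    assert (Cmod (f w) ^ 2 <= M ^ 2) by (apply pow_incr; split; [apply Cmod_ge_0|trivial]).
    assert (0 <= e * Cmod z1 ^ 2) by (apply Rmult_le_pos; [lra|apply pow2_ge_0]).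
    assert (e * r ^ 2 <= e * 1) by (apply Rmult_le_compat_l; nra).
    unfold e in *. nra. }
  destruct (quotient_by_four_point_mean D f w HD D0 Hf ltac:(lra)) as [d [K [Hd [HK Hmean]]]].
  (* The four points must stay in the disc of radius [r], and [t <= e / K] makes the loss
     [K * t ^ 3] smaller than the gain [4 * e * t ^ 2] contributed by [e * Cmod z ^ 2]. *)
  set (t := Rmin (Rmin (d / 2) (r - Cmod w)) (e / K)).
  assert (0 < e / K) by (apply Rdiv_lt_0_compat; lra).
  assert (Ht : 0 < t) by (unfold t; repeat apply Rmin_pos; lra).
  assert (t <= d / 2 /\ t <= r - Cmod w /\ t <= e / K) as [Ht1 [Ht2 Ht3]].
  { unfold t. pose proof (Rmin_l (Rmin (d / 2) (r - Cmod w)) (e / K)).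
    pose proof (Rmin_r (Rmin (d / 2) (r - Cmod w)) (e / K)).
    pose proof (Rmin_l (d / 2) (r - Cmod w)). pose proof (Rmin_r (d / 2) (r - Cmod w)). lra. }
  specialize (Hmean t ltac:(lra)).
  assert (below : forall h, Cmod h = t -> u (w + h)%C <= u w).
  { intros h Hh. apply Hmax. pose proof (Cmod_triangle w h). lra. }
  assert (Mt : Cmod (RtoC t) = t) by (rewrite Cmod_R, Rabs_pos_eq; lra).
  assert (Mi : Cmod (Ci * RtoC t) = t) by (rewrite Cmod_mult, Cmod_Ci, Mt; ring).
  pose proof (below _ Mt) as B1. pose proof (below _ Mi) as B3.
  assert (B2 := below (- RtoC t)%C). rewrite Cmod_opp in B2. specialize (B2 Mt).
  assert (B4 := below (- (Ci * RtoC t))%C). rewrite Cmod_opp in B4. specialize (B4 Mi).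
  pose proof (four_point_mean_quadratic w 1 0 t) as Q.
  rewrite !Cmod_1, !Cmod_0, !Cmult_1_l, !Cmult_0_l, !Cplus_0_r in Q.
  unfold u in *.
  assert (K * t ^ 3 <= e * t ^ 2).
  { replace (K * t ^ 3) with (K * t * t ^ 2) by ring.
    apply Rmult_le_compat_r; [apply pow2_ge_0|].
    replace e with (K * (e / K)) by (field; lra). apply Rmult_le_compat_l; lra. }
  assert (0 < e * t ^ 2) by (apply Rmult_lt_0_compat; [lra|apply pow_lt; lra]).
  nra.
Qed.

(** * Schwarz and Schwarz-Pick for quotients *)

Lemma Rle_of_mul_lt_1 (x y : R) : (forall s, 0 < s < 1 -> s * x <= y) -> x <= y.
Proof.
  intros H. apply Rnot_lt_le; intros Hlt.
  (* This instance forces [x > 0] when [y < x], which makes [(x + y) / (2 * x)] an admissible value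
     of [s]. *)
  pose proof (H (1 / 2) ltac:(lra)).
  assert (0 < (x + y) / (2 * x) < 1).
  { split; [apply Rdiv_lt_0_compat; lra|].
    apply Rmult_lt_reg_r with (2 * x); [lra|].
    replace ((x + y) / (2 * x) * (2 * x)) with (x + y) by (field; lra). lra. }
  specialize (H ((x + y) / (2 * x)) ltac:(lra)).
  replace ((x + y) / (2 * x) * x) with ((x + y) / 2) in H by (field; lra). lra.
Qed.

(** On the circle of radius [r] the hypothesis reads [Cmod (N / D) <= / r]; the maximum principle
    carries this inside, and [r] tends to 1. *)
Lemma quotient_schwarz (N D : C -> C) :
  holomorphic N -> holomorphic D -> (forall z, Cmod z < 1 -> D z <> 0) ->
  (forall z, Cmod z < 1 -> Cmod (z * N z) <= Cmod (D z)) ->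
  forall z, Cmod z < 1 -> Cmod (N z) <= Cmod (D z).
Proof.
  intros HN HD D0 H z Hz.
  assert (Dz : 0 < Cmod (D z)) by (apply Cmod_gt_0; auto).
  assert (bound : forall r, 0 < r < 1 -> Cmod z <= r -> r * Cmod (N z) <= Cmod (D z)).
  { intros r Hr Hzr.
    assert (Q : Cmod (N z / D z) <= / r).
    { apply (quotient_by_max_principle D (fun z => N z / D z)%C r); trivial.
      - now exists N.
      - intros v Hv. assert (Dv : D v <> 0) by (apply D0; lra).
        rewrite Cmod_div by trivial. apply Cmod_gt_0 in Dv.
        specialize (H v ltac:(lra)). rewrite Cmod_mult, Hv in H.
        apply Rmult_le_reg_r with (r * Cmod (D v)); [apply Rmult_lt_0_compat; lra|].
        replace (Cmod (N v) / Cmod (D v) * (r * Cmod (D v))) with (r * Cmod (N v))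
          by (field; lra).
        replace (/ r * (r * Cmod (D v))) with (Cmod (D v)) by (field; lra). trivial. }
    rewrite Cmod_div in Q by auto.
    apply Rmult_le_compat_r with (r := r * Cmod (D z)) in Q; [|nra].
    replace (Cmod (N z) / Cmod (D z) * (r * Cmod (D z))) with (r * Cmod (N z)) in Q
      by (field; lra).
    replace (/ r * (r * Cmod (D z))) with (Cmod (D z)) in Q by (field; lra). trivial. }
  pose proof (Cmod_ge_0 (N z)). pose proof (Cmod_ge_0 z).
  apply Rle_of_mul_lt_1. intros s Hs.
  (* A circle of radius [s] below [Cmod z] does not enclose [z]; the radius [Cmod z] then gives a
     stronger inequality. *)
  destruct (Rle_dec (Cmod z) s); [now apply bound|].
  destruct (Req_dec (Cmod z) 0) as [Z|Z]; [lra|].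
  apply Rle_trans with (Cmod z * Cmod (N z)); [nra|]. apply bound; lra.
Qed.

(* Schwarz-Pick to first order for [N / D]: with [phi] the disc automorphism
   sending [n 0 / d 0] to [0], Schwarz applied to [phi (N / D) / z] bounds its value
   at [0]. The scaling of [N] by [s < 1] keeps the denominator nonzero. *)
Lemma schwarz_pick_coeff (n d : nat -> C) (N D : C -> C) :
  has_power_series n N -> has_power_series d D ->
  (forall z, Cmod z < 1 -> D z <> 0) ->
  (forall z, Cmod z < 1 -> Cmod (z * N z) <= Cmod (D z)) ->
  Cmod (d 0%nat * n 1%nat - n 0%nat * d 1%nat)
    <= Cmod (d 0%nat) ^ 2 - Cmod (n 0%nat) ^ 2.
Proof.
  intros Hn Hd D0 HND.
  assert (Hle := quotient_schwarz N D (ex_intro _ n Hn) (ex_intro _ d Hd) D0 HND).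
  destruct (power_series_factor_0 n N Hn) as [N1 [HN1 EN]].
  destruct (power_series_factor_0 d D Hd) as [D1 [HD1 ED]].
  assert (Z0 : Cmod 0 < 1) by (rewrite Cmod_0; lra).
  assert (le0 := Hle 0%C Z0). assert (ne0 := D0 0%C Z0).
  rewrite (power_series_at_0 n N Hn), (power_series_at_0 d D Hd) in le0.
  rewrite (power_series_at_0 d D Hd) in ne0. apply Cmod_gt_0 in ne0.
  assert (N10 := power_series_at_0 _ _ HN1). assert (D10 := power_series_at_0 _ _ HD1).
  set (n0 := n 0%nat) in *. set (d0 := d 0%nat) in *.
  cbv beta in N10, D10. rewrite <- N10, <- D10.
  pose proof (Cmod_ge_0 n0).
  set (X := Cmod (d0 * N1 0 - n0 * D1 0)).
  assert (scaled : forall s, 0 < s < 1 -> s * X <= Cmod d0 ^ 2 - s ^ 2 * Cmod n0 ^ 2).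
  { intros s Hs.
    (* Up to a unimodular constant, [z * Q / E] is the disc automorphism sending [s * n0 / d0] to 0,
       applied to [s * N / D], with denominators cleared. *)
    set (Q := fun z => ((RtoC s * d0) * N1 z + (- (RtoC s * n0)) * D1 z)%C).
    set (E := fun z => (Cconj d0 * D z + (- (RtoC s * RtoC s * Cconj n0)) * N z)%C).
    assert (HQ : holomorphic Q) by (apply holomorphic_lincomb; eexists; eassumption).
    assert (HE : holomorphic E) by (apply holomorphic_lincomb; eexists; eassumption).
    assert (s2 : 0 < s * s < 1) by nra.
    assert (small : forall z, Cmod z < 1 ->
      s * s * (Cmod n0 * Cmod (N z)) < Cmod d0 * Cmod (D z)).
    { intros z Hz. specialize (Hle z Hz).
      assert (0 < Cmod (D z)) by (apply Cmod_gt_0; auto).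
      assert (Cmod n0 * Cmod (N z) <= Cmod d0 * Cmod (D z))
        by (apply Rmult_le_compat; trivial; apply Cmod_ge_0).
      assert (0 < Cmod d0 * Cmod (D z)) by (apply Rmult_lt_0_compat; lra). nra. }
    assert (bound : forall z, Cmod z < 1 -> Cmod (Q z) <= Cmod (E z)).
    { apply quotient_schwarz; trivial.
      - intros z Hz EQ0. specialize (small z Hz).
        assert (EQ : (Cconj d0 * D z)%C = (RtoC s * RtoC s * Cconj n0 * N z)%C).
        { replace (Cconj d0 * D z)%C with (E z + RtoC s * RtoC s * Cconj n0 * N z)%C
            by (unfold E; ring). rewrite EQ0; ring. }
        apply (f_equal Cmod) in EQ. rewrite !Cmod_mult, !Cmod_conj, !Cmod_R in EQ.
        rewrite (Rabs_pos_eq s) in EQ; lra.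
      - intros z Hz. specialize (Hle z Hz).
        replace (z * Q z)%C with (RtoC s * (d0 * N z) - RtoC s * (n0 * D z))%C
          by (unfold Q; rewrite (EN z Hz), (ED z Hz); fold n0 d0; ring).
        apply Rsqr_incr_0; try apply Cmod_ge_0. rewrite !Rsqr_pow2.
        (* The homogeneous form of the identity for 1 minus the squared modulus of a disc
           automorphism; both factors on the right are nonnegative. *)
        assert (id : Cmod (E z) ^ 2 - Cmod (RtoC s * (d0 * N z) - RtoC s * (n0 * D z)) ^ 2
          = (Cmod d0 ^ 2 - s * s * Cmod n0 ^ 2) * (Cmod (D z) ^ 2 - s * s * Cmod (N z) ^ 2)).
        { unfold E. rewrite !Cmod2_alt.
          destruct d0, n0, (N z), (D z). simpl. ring. }
        pose proof (Cmod_ge_0 (N z)).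
        assert (0 <= Cmod d0 ^ 2 - s * s * Cmod n0 ^ 2).
        { assert (Cmod n0 ^ 2 <= Cmod d0 ^ 2) by (apply pow_incr; lra).
          pose proof (pow2_ge_0 (Cmod n0)). nra. }
        assert (0 <= Cmod (D z) ^ 2 - s * s * Cmod (N z) ^ 2).
        { assert (Cmod (N z) ^ 2 <= Cmod (D z) ^ 2) by (apply pow_incr; lra).
          pose proof (pow2_ge_0 (Cmod (N z))). nra. }
        nra. }
    specialize (bound 0%C Z0). unfold Q, E in bound.
    rewrite (power_series_at_0 n N Hn), (power_series_at_0 d D Hd) in bound.
    fold n0 d0 in bound.
    replace (RtoC s * d0 * N1 0 + - (RtoC s * n0) * D1 0)%C
      with (RtoC s * (d0 * N1 0 - n0 * D1 0))%C in bound by ring.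
    replace (Cconj d0 * d0 + - (RtoC s * RtoC s * Cconj n0) * n0)%C
      with (RtoC (Cmod d0 ^ 2 - s ^ 2 * Cmod n0 ^ 2)) in bound.
    2: { rewrite !Cmod2_alt. destruct d0, n0. unfold RtoC, Cconj, Cmult, Cplus, Copp; simpl.
         f_equal; ring. }
    rewrite Cmod_mult, !Cmod_R, (Rabs_pos_eq s) in bound by lra.
    rewrite Rabs_pos_eq in bound; [exact bound|].
    assert (Cmod n0 ^ 2 <= Cmod d0 ^ 2) by (apply pow_incr; lra).
    pose proof (pow2_ge_0 (Cmod n0)). nra. }
  assert (0 <= X) by apply Cmod_ge_0.
  assert (X + Cmod n0 ^ 2 <= Cmod d0 ^ 2); [|lra].
  apply Rle_of_mul_lt_1. intros s Hs.
  (* Scaling by [sqrt s] turns [s ^ 2] into [s]; with [s <= sqrt s] both terms then carry the factor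
     [s]. *)
  assert (R1 : 0 < sqrt s < 1).
  { split; [apply sqrt_lt_R0; lra|]. rewrite <- sqrt_1. apply sqrt_lt_1; lra. }
  pose proof (pow2_sqrt s ltac:(lra)) as R2.
  specialize (scaled (sqrt s) R1). rewrite R2 in scaled.
  assert (s <= sqrt s) by nra. nra.
Qed.

(** * Convex functions *)

Lemma in_disk_Cmod (z : Cx) : in_disk z <-> Cmod z < 1.
Proof.
  unfold in_disk. replace (Cnorm2 z) with (Cmod z ^ 2).
  - pose proof (Cmod_ge_0 z). split; intros; nra.
  - rewrite Cmod2_alt. unfold Cnorm2, Re, Im. ring.
Qed.

Lemma Defs_Cinv (z : Cx) : Defs.Cinv z = Cinv z.
Proof.
  unfold Defs.Cinv, Cinv, Cnorm2.
  replace (fst z * fst z + snd z * snd z) with (fst z ^ 2 + snd z ^ 2) by ring.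
  reflexivity.
Qed.

(** The difference of the squared moduli is [4 * Re (1 + q)]. *)
Lemma Re_pos_cayley (q : C) : 0 < Re (1 + q) -> Cmod q < Cmod (2 + q).
Proof.
  intros H. apply Rsqr_incrst_0; try apply Cmod_ge_0.
  rewrite !Rsqr_pow2, !Cmod2_alt. destruct q. simpl in *. nra.
Qed.

Lemma Cnat_mul (n : nat) (z : Cx) : Cmul (Cnat n) z = (RtoC (INR n) * z)%C.
Proof. reflexivity. Qed.

Lemma convex_fun_coeff (a : nat -> Cx) :
  convex_fun a ->
  3 * Cmod (a 3%nat - a 2%nat * a 2%nat) <= 1 - Cmod (a 2%nat) ^ 2.
Proof.
  intros [[Han [Ha0 Ha1]] Hconv].
  destruct (coeff_bound_power_series (deriv1 a)) as [F HF].
  { apply coeff_bound_of_Csum. intros z Hz.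
    destruct (Hconv z (proj2 (in_disk_Cmod z) Hz)) as [d1 [d2 [H1 _]]].
    exists d1. now apply Cseries_sum_Csum in H1. }
  destruct (coeff_bound_power_series (deriv2 a)) as [N HN].
  { apply coeff_bound_of_Csum. intros z Hz.
    destruct (Hconv z (proj2 (in_disk_Cmod z) Hz)) as [d1 [d2 [_ [H2 _]]]].
    exists d2. now apply Cseries_sum_Csum in H2. }
  assert (HD := power_series_lincomb 2 1 _ _ _ _ HF (power_series_mul_id _ _ HN)).
  (* With [F] and [N] the sums for [f'] and [f''], this is the Cayley bound for [z f'' / f']
     multiplied by [f']. Strictness also keeps the denominator [2 f' + z f''] away from zero. *)
  assert (strict : forall z, Cmod z < 1 ->
    Cmod (z * N z) < Cmod (2 * F z + 1 * (z * N z))).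
  { intros z Hz.
    destruct (Hconv z (proj2 (in_disk_Cmod z) Hz)) as [d1 [d2 [H1 [H2 [H3 H4]]]]].
    apply Cseries_sum_Csum in H1, H2.
    rewrite (Csum_unique _ _ _ (proj2 HF z Hz) H1), (Csum_unique _ _ _ (proj2 HN z Hz) H2).
    rewrite Defs_Cinv in H4. change (0 < Re (1 + z * (d2 * / d1))) in H4.
    assert (d1n : d1 <> RtoC 0) by exact H3.
    apply Re_pos_cayley in H4.
    replace (z * d2)%C with (d1 * (z * (d2 * / d1)))%C by (field; trivial).
    replace (2 * d1 + 1 * (d1 * (z * (d2 * / d1))))%C
      with (d1 * (2 + z * (d2 * / d1)))%C by ring.
    rewrite (Cmod_mult d1 (z * (d2 * / d1))), (Cmod_mult d1 (2 + _)).
    apply Rmult_lt_compat_l; trivial. now apply Cmod_gt_0. }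
  assert (P := schwarz_pick_coeff _ _ _ _ HN HD).
  cbv beta iota in P.
  (* The first coefficients are [2 a2], [6 a3] for the numerator and [2], [6 a2] for the
     denominator; dividing by 4 gives the claim. *)
  assert (Q : Cmod (12 * (a 3%nat - a 2%nat * a 2%nat))
    <= Cmod 2 ^ 2 - Cmod (2 * a 2%nat) ^ 2).
  { replace (RtoC 2) with (2 * deriv1 a 0 + 1 * 0)%C at 1.
    2: { unfold deriv1. rewrite Ha1. simpl. unfold Cmul, Cplus, Cmult, RtoC; simpl. f_equal; ring. }
    replace (2 * a 2%nat)%C with (deriv2 a 0).
    2: { unfold deriv2. rewrite Cnat_mul. simpl. do 2 f_equal; ring. }
    replace (12 * (a 3%nat - a 2%nat * a 2%nat))%C
      with ((2 * deriv1 a 0 + 1 * 0) * deriv2 a 1 -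
            deriv2 a 0 * (2 * deriv1 a 1 + 1 * deriv2 a 0))%C.
    2: { unfold deriv1, deriv2. rewrite Ha1, !Cnat_mul.
         change Defs.C1 with (RtoC 1).
         simpl INR. rewrite !RtoC_plus. ring. }
    apply P; intros z Hz.
    - apply Cmod_gt_0. eapply Rle_lt_trans; [apply Cmod_ge_0|apply strict, Hz].
    - apply Rlt_le, strict, Hz. }
  rewrite !Cmod_mult, !Cmod_R, !Rabs_pos_eq in Q by lra. lra.
Qed.

Lemma detT31_eq (a : nat -> Cx) :
  detT31 a = (1 - Cmod (a 2%nat) ^ 2) ^ 2 - Cmod (a 3%nat - a 2%nat * a 2%nat) ^ 2.
Proof.
  unfold detT31. rewrite !Cmod2_alt. destruct (a 2%nat), (a 3%nat).
  unfold Cnorm2; simpl. ring.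
Qed.

(** * Differentiated series and the extremal functions *)

(** Bernoulli's inequality for [/ q = 1 + x] gives [INR n * q ^ n <= / x]. *)
Lemma succ_mul_pow_bounded (q : R) :
  0 < q < 1 -> exists B, forall n, INR (S n) * q ^ n <= B.
Proof.
  intros Hq. set (x := / q - 1).
  assert (Hx : 0 < x).
  { unfold x. assert (1 < / q); [|lra]. rewrite <- Rinv_1. apply Rinv_lt_contravar; lra. }
  exists (1 + / x). intros n.
  pose proof (poly n x Hx) as Bern.
  replace (1 + x) with (/ q) in Bern by (unfold x; ring).
  assert (Hp : 0 < q ^ n <= 1).
  { split; [apply pow_lt; lra|]. rewrite <- (pow1 n). apply pow_incr; lra. }
  rewrite pow_inv in Bern.
  assert (E : INR n * x * q ^ n <= 1).
  { apply Rmult_le_compat_r with (r := q ^ n) in Bern; [|lra].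
    rewrite Rinv_l in Bern by lra. nra. }
  rewrite S_INR, Rmult_plus_distr_r.
  assert (INR n * q ^ n <= / x).
  { apply Rmult_le_reg_r with x; [lra|]. rewrite Rinv_l; lra. }
  lra.
Qed.

(** For [t < t' < 1] the factor [INR (S n)] is absorbed by [(t / t') ^ n]. *)
Lemma coeff_bound_derivative (a : nat -> C) :
  coeff_bound a -> coeff_bound (fun n => RtoC (INR (S n)) * a (S n))%C.
Proof.
  intros Ha t Ht. set (t' := (1 + t) / 2).
  assert (Hq : 0 < t / t' < 1).
  { split; [apply Rdiv_lt_0_compat; unfold t'; lra|].
    apply Rmult_lt_reg_r with t'; [unfold t'; lra|].
    replace (t / t' * t') with t by (field; unfold t'; lra). unfold t'; lra. }
  destruct (succ_mul_pow_bounded _ Hq) as [A HA].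
  destruct (Ha t') as [B HB]; [unfold t'; lra|].
  exists (A * (B / t')). intros n.
  rewrite Cmod_mult, Cmod_R, Rabs_pos_eq by apply pos_INR.
  replace (INR (S n) * Cmod (a (S n)) * t ^ n)
    with (INR (S n) * (t / t') ^ n * (Cmod (a (S n)) * t' ^ n)).
  - apply Rmult_le_compat.
    + apply Rmult_le_pos; [apply pos_INR|apply pow_le; lra].
    + apply Rmult_le_pos; [apply Cmod_ge_0|apply pow_le; unfold t'; lra].
    + apply HA.
    + apply Rmult_le_reg_r with t'; [unfold t'; lra|].
      replace (B / t' * t') with B by (field; unfold t'; lra).
      specialize (HB (S n)). simpl in HB. lra.
  - replace (t ^ n) with ((t / t') ^ n * t' ^ n); [ring|].
    rewrite <- Rpow_mult_distr. f_equal. field. unfold t'; lra.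
Qed.

Lemma coeff_bound_of_le_1 (a : nat -> C) : (forall n, Cmod (a n) <= 1) -> coeff_bound a.
Proof.
  intros H t Ht. exists 1. intros n.
  replace 1 with (1 * 1 ^ n) by (rewrite pow1; ring).
  apply Rmult_le_compat; [apply Cmod_ge_0|apply pow_le; lra|apply H|].
  apply pow_incr; lra.
Qed.

Lemma coeff_bound_analytic (a : nat -> C) : coeff_bound a -> analytic_on_disk a.
Proof.
  intros H z Hz. destruct (coeff_bound_power_series a H) as [F HF].
  exists (F z). apply Cseries_sum_Csum. apply HF. now apply in_disk_Cmod.
Qed.

Lemma Csum_first (c : nat -> C) (l : C) :
  c 0%nat = l -> (forall n, c (S n) = 0%C) -> Csum c l.
Proof.
  intros <- H. replace (c 0%nat) with (0 + c 0%nat)%C by ring. apply Csum_incr_1.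
  apply Csum_ext with (fun _ => 0%C); [intros; now rewrite H|].
  assert (Z : is_series (fun _ : nat => 0) 0).
  { apply (is_lim_seq_ext (fun _ => 0) _ 0); [|apply is_lim_seq_const].
    induction n as [|n IH]; [now rewrite sum_O|].
    rewrite sum_Sn, <- IH. unfold plus; simpl; ring. }
  now split.
Qed.

Lemma identity_convex :
  exists a, convex_fun a /\ detT31 a = 1.
Proof.
  exists (fun n => match n with 1%nat => RtoC 1 | _ => RtoC 0 end).
  split.
  - split; [split; [|split; reflexivity]|].
    + apply coeff_bound_analytic, coeff_bound_of_le_1.
      intros [|[|n]]; rewrite ?Cmod_0, ?Cmod_1; lra.
    + intros z Hz. exists (RtoC 1), (RtoC 0). rewrite !Cseries_sum_Csum.
      split; [|split; [|split]].
      * apply Csum_first; [|intros n]; unfold deriv1, Cmul; simpl; unfold RtoC; f_equal; ring.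
      * apply Csum_first; [|intros n]; unfold deriv2, Cmul; simpl; unfold RtoC; f_equal; ring.
      * unfold RtoC, C0. intros E; inversion E; lra.
      * unfold Cre, Cadd, Cmul; simpl. lra.
  - rewrite detT31_eq. rewrite !Cmod2_alt. simpl. ring.
Qed.

(** Multiplying by [1 - z] takes successive differences of coefficients; repeated use evaluates the
    derivatives of [z / (1 - z)]. *)
Lemma power_series_mul_1_minus (a b : nat -> C) (F : C -> C) (z l : C) :
  has_power_series a F -> Cmod z < 1 ->
  (forall n, b n = a n - match n with O => RtoC 0 | S m => a m end)%C ->
  Csum (fun n => b n * z ^ n)%C l -> ((1 - z) * F z)%C = l.
Proof.
  intros HF Hz Hb Hl.
  assert (HG := power_series_lincomb 1 (-1) _ _ _ _ HF (power_series_mul_id _ _ HF)).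
  replace ((1 - z) * F z)%C with (1 * F z + -1 * (z * F z))%C by ring.
  refine (Csum_unique _ _ _ (proj2 HG z Hz) _).
  revert Hl. apply Csum_ext. intros n. rewrite Hb. ring.
Qed.

Lemma half_plane_map_convex :
  exists a, convex_fun a /\ detT31 a = 0.
Proof.
  set (a := fun n => match n with O => RtoC 0 | S _ => RtoC 1 end).
  assert (Ha : coeff_bound a).
  { apply coeff_bound_of_le_1. intros [|n]; unfold a; rewrite ?Cmod_0, ?Cmod_1; lra. }
  exists a. split.
  - split; [split; [now apply coeff_bound_analytic|split; reflexivity]|].
    destruct (coeff_bound_power_series (fun _ => RtoC 1)) as [G0 H0].
    { apply coeff_bound_of_le_1. intros; rewrite Cmod_1; lra. }
    assert (Hd1 := coeff_bound_derivative a Ha).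
    assert (Hd2 := coeff_bound_derivative _ Hd1).
    destruct (coeff_bound_power_series _ Hd1) as [G1 H1].
    destruct (coeff_bound_power_series _ Hd2) as [G2 H2].
    intros z Hz. apply in_disk_Cmod in Hz. cbv beta in *.
    assert (E0 : ((1 - z) * G0 z)%C = 1%C).
    { apply (power_series_mul_1_minus _
        (fun n => match n with O => RtoC 1 | S _ => RtoC 0 end) _ _ _ H0 Hz).
      - intros [|n]; simpl; ring.
      - apply Csum_first; [simpl|intros n]; ring. }
    assert (E1 : ((1 - z) * G1 z)%C = G0 z).
    { apply (power_series_mul_1_minus _ (fun n => RtoC 1) _ _ _ H1 Hz).
      - intros [|n]; unfold a; [simpl; ring|].
        rewrite (S_INR (S n)), RtoC_plus. ring.
      - apply H0, Hz. }
    (* The coefficients [(n + 1)(n + 2)] of [f''] have differences [2 (n + 1)], twice the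
       coefficients of [f']. *)
    assert (E2 : ((1 - z) * G2 z)%C = (2 * G1 z)%C).
    { apply (power_series_mul_1_minus _
        (fun n => 2 * (RtoC (INR (S n)) * a (S n)))%C _ _ _ H2 Hz).
      - intros [|n]; unfold a.
        + simpl. rewrite RtoC_plus. ring.
        + rewrite !S_INR, !RtoC_plus. ring.
      - apply Csum_ext with (fun n => 2 * (RtoC (INR (S n)) * a (S n) * z ^ n))%C;
          [intros; ring|]. apply Csum_scal, H1, Hz. }
    assert (nz : (1 - z)%C <> 0%C).
    { intros E. rewrite E in E0. rewrite Cmult_0_l in E0. inversion E0; lra. }
    assert (V1 : G1 z = (/ ((1 - z) * (1 - z)))%C).
    { transitivity ((1 - z) * ((1 - z) * G1 z) / ((1 - z) * (1 - z)))%C; [field; trivial|].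
      rewrite E1, E0. field; trivial. }
    assert (V2 : G2 z = (2 * G1 z / (1 - z))%C).
    { rewrite <- E2. field; trivial. }
    assert (nz1 : G1 z <> 0%C).
    { intros E. rewrite E, Cmult_0_r in E1. rewrite <- E1, Cmult_0_r in E0.
      inversion E0; lra. }
    exists (G1 z), (G2 z). rewrite !Cseries_sum_Csum.
    split; [|split; [|split]].
    + apply Csum_ext with (2 := proj2 H1 z Hz). reflexivity.
    + apply Csum_ext with (2 := proj2 H2 z Hz). intros n.
      unfold deriv2. rewrite Cnat_mul, mult_INR, RtoC_mult.
      change (Cmul ?x ?y) with (x * y)%C. change (Defs.Cpow z n) with (z ^ n)%C. ring.
    + exact nz1.
    + rewrite Defs_Cinv. change (0 < Re (1 + z * (G2 z * / G1 z))).
      rewrite V2.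
      (* The half-plane map [(1 + z) / (1 - z)], with real part [(1 - |z|^2) / |1 - z|^2]. *)
      replace (1 + z * (2 * G1 z / (1 - z) * / G1 z))%C
        with ((1 + z) / (1 - z))%C by (field; auto).
      assert (P : 0 < Re (1 - z) ^ 2 + Im (1 - z) ^ 2).
      { rewrite <- Cmod2_alt. apply pow_lt. now apply Cmod_gt_0. }
      assert (Hz2 : Re z ^ 2 + Im z ^ 2 < 1).
      { rewrite <- Cmod2_alt. pose proof (Cmod_ge_0 z). nra. }
      replace (Re ((1 + z) / (1 - z)))
        with ((1 - (Re z ^ 2 + Im z ^ 2)) / (Re (1 - z) ^ 2 + Im (1 - z) ^ 2)).
      * apply Rdiv_lt_0_compat; lra.
      * destruct z as [x y]. simpl in *. field. simpl in P. nra.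
  - rewrite detT31_eq, !Cmod2_alt. simpl. ring.
Qed.

Theorem theorem3 :
  (forall a : nat -> Cx, convex_fun a -> 0 <= detT31 a <= 1) /\
  (exists a : nat -> Cx, convex_fun a /\ detT31 a = 0) /\
  (exists a : nat -> Cx, convex_fun a /\ detT31 a = 1).
Proof.
  split; [|split; [exact half_plane_map_convex|exact identity_convex]].
  (* With [x = 1 - |a2|^2] and [y = |a3 - a2^2|], the facts [0 <= 3 y <= x <= 1] give
     [0 <= x^2 - y^2 <= 1]. *)
  intros a Ha. apply convex_fun_coeff in Ha. rewrite detT31_eq.
  pose proof (Cmod_ge_0 (a 3%nat - a 2%nat * a 2%nat)).
  pose proof (pow2_ge_0 (Cmod (a 2%nat))). split; nra.
Qed.
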